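(* Let $r>0$ and $N\ge 2r+1$ be integers and let $A=\{A_{ij}\}_{i,j=1}^N$ be a complex band matrix of order $r$, i.e. $A_{ij}=0$ for $|i-j|>r$. The matrix $A$ admits the factorization $A=UR$, where $U$ is a unitary matrix represented as the product $$U=\tilde U_1\tilde U_2\cdots\tilde U_{N-r}\tilde U_{N-r+1},\qquad \tilde U_k=I_{k-1}\oplus U_k\oplus I_{N-k-r}\ (k=1,\dots,N-r),\qquad \tilde U_{N-r+1}=I_{N-r}\oplus \hat U_{N-r+1},$$ with $(r+1)\times(r+1)$ unitary matrices $U_k$ and an $r\times r$ unitary matrix $\hat U_{N-r+1}$, and $R$ is an upper triangular, upper band matrix of order $2r$. Moreover these unitary matrices and the nonzero upper triangular entries of $R$ are obtained as follows. 1.1. Set $\tilde Y_0=A(1:r,1:2r+1)$. 1.2. For $k=1,\dots,N-2r-1$: set $\Delta_k=\begin{pmatrix}\tilde Y_{k-1}(:,1)\\ A(k+r,k)\end{pmatrix}$ and determine an $(r+1)\times(r+1)$ unitary matrix $U_k$ and a number $x_k$ with $U_k^*\Delta_k=\begin{pmatrix}x_k\\ 0_{r\times1}\end{pmatrix}$. Compute the $(r+1)\times 2r$ matrix $$\tilde Z_k=U_k^*\begin{pmatrix}\tilde Y_{k-1}(:,2:2r)&0_{r\times1}\\ A(k+r,k+1:k+2r-1)&A(k+r,k+2r)\end{pmatrix}$$ and determine the $2r$-dimensional row $\tilde X_k$ and the $r\times2r$ matrix $\tilde Y_k$ from $\tilde Z_k=\begin{pmatrix}\tilde X_k\\ \tilde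 Y_k\end{pmatrix}$. Set $R(k,k)=x_k$, $R(k,k+1:k+2r)=\tilde X_k$. 1.3. Let $Y_{N-2r-1}$ be the $r\times(2r+1)$ matrix equal to $\tilde Y_0$ if $N=2r+1$, and to $\begin{pmatrix}\tilde Y_{N-2r-1}&0_{r\times1}\end{pmatrix}$ if $N>2r+1$. For $k=N-2r,\dots,N-r$: set $\Delta_k=\begin{pmatrix}Y_{k-1}(:,1)\\ A(k+r,k)\end{pmatrix}$, determine an $(r+1)\times(r+1)$ unitary matrix $U_k$ and a number $x_k$ with $U_k^*\Delta_k=\begin{pmatrix}x_k\\ 0_{r\times1}\end{pmatrix}$, compute $$Z_k=U_k^*\begin{pmatrix}Y_{k-1}(:,2:N-k+1)\\ A(k+r,k+1:N)\end{pmatrix}=\begin{pmatrix}X_k\\ Y_k\end{pmatrix}$$ with $X_k$ of size $1\times(N-k)$ and $Y_k$ of size $r\times(N-k)$, and set $R(k,k)=x_k$, $R(k,k+1:N)=X_k$, $\tilde X_k=X_k$. 1.4. Compute a QR factorization $Y_{N-r}=\hat U_{N-r+1}Z_{N-r+1}$ of the $r\times r$ matrix $Y_{N-r}$, with $\hat U_{N-r+1}$ unitary and $Z_{N-r+1}$ upper triangular, and set $R(N-r+1:N,N-r+1:N)=Z_{N-r+1}$. Next, if $A$ is invertible, lower Green generators $p(i),q(i),a(i)$ $(i=1,\dots,N-r)$, $p(N-r+1)$ of the matrix $A^{-1}=R^{-1}U^*$ are obtained as follows, where $p_U(i),d_U(i),a_U(i),q_U(i)$ (of sizes $1\times r$,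 $1\times1$, $r\times r$, $r\times 1$) are defined by the partitions $U_i^*=\begin{pmatrix}p_U(i)&d_U(i)\\ a_U(i)&q_U(i)\end{pmatrix}$, $i=1,\dots,N-r$. 2.1. Set $q(k)=q_U(k)$, $a(k)=a_U(k)$, $k=1,\dots,N-r$. 2.2.1. Set $p(N-r+1)=Z_{N-r+1}^{-1}\hat U_{N-r+1}^*$, $P_{N-r+1}=p(N-r+1)$, and for $k=N-r,\dots,N-2r+1$ compute $$p(k)=\frac1{x_k}\bigl(p_U(k)-\tilde X_kP_{k+1}a(k)\bigr),\qquad P_k=\begin{pmatrix}p(k)\\ P_{k+1}a(k)\end{pmatrix}.$$ 2.2.2. Set $t_{N-2r+1}=P_{N-2r+1}$ and for $k=N-2r,\dots,1$ compute $$p(k)=\frac1{x_k}\bigl(p_U(k)-\tilde X_kt_{k+1}a(k)\bigr),\qquad t_k=\begin{pmatrix}p(k)\\ t_{k+1}(1:2r-1,:)\,a(k)\end{pmatrix}.$$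
   Context: Notation: $M(i:j,k:l)$ denotes the submatrix of $M$ with rows $i,\dots,j$ and columns $k,\dots,l$ (a single index denotes one row or column, '':'' alone means all indices; empty ranges give empty blocks). $I_k$ is the identity of order $k$ ($I_0$ empty), $\oplus$ is the block diagonal direct sum. A matrix $R$ is upper band of order $s$ if $R_{ij}=0$ for $j-i>s$. Lower Green generators. Let $p(i)$ ($1\times r$), $q(i)$ ($r\times1$), $a(i)$ ($r\times r$), $i=1,\dots,N-r$, and an $r\times r$ matrix $p(N-r+1)$ be given. They are lower Green generators (of order $r$) of an $N\times N$ matrix $B$ if, with empty products of $a$'s equal to $I_r$: $B(i,1:r)=p(i)a(i-1)\cdots a(1)$ for $1\le i\le N-r$; $B(i,r+j)=p(i)a(i-1)\cdots a(j+1)q(j)$ for $1\le j<i\le N-r$; $B(N-r+1:N,1:r)=p(N-r+1)a(N-r)\cdots a(1)$; $B(N-r+1:N,r+j)=p(N-r+1)a(N-r)\cdots a(j+1)q(j)$ for $1\le j\le N-r$. *)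

(* Defs.v *)
From mathcomp Require Import all_boot all_order all_algebra.

Set Implicit Arguments.
Unset Strict Implicit.
Unset Printing Implicit Defensive.

Import Order.TTheory GRing.Theory Num.Theory.
Local Open Scope ring_scope.
Local Open Scope sesquilinear_scope.

(* Conventions. Row, column and step indices of type nat are 1-based.
   The sequences indexed by nat (U_k, x_k, p(k), etc.) are only constrained for
   the indices k that the algorithm visits; other values are irrelevant.
   [conform_mx 0 M] is used only as a transport of M along an arithmetic
   identity between dimensions, such as (2r - 1) + 1 = 2r, that is provable
   for the indices k concerned. *)

Section Blocks.
Variables (C : numClosedFieldType).

Definition entry m n (M : 'M[C]_(m, n)) (i j : nat) : C :=
  match insub i.-1, insub j.-1 with
  | Some i0, Some j0 => M i0 j0
  | _, _ => 0
  end.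

(* M(i : i + m' - 1, k : k + n' - 1); the size (m', n') of the block is read
   off the expected type. *)
Definition slice m n (M : 'M[C]_(m, n)) (i k : nat) {m' n' : nat} :
    'M[C]_(m', n') :=
  \matrix_(a < m', b < n') entry M (i + a) (k + b).

Definition dsum m n (V : 'M[C]_m) (W : 'M[C]_n) : 'M[C]_(m + n) :=
  block_mx V 0 0 W.

Definition band n (s : nat) (M : 'M[C]_n) : Prop :=
  forall i j : 'I_n, (s < `|i - j|)%N -> M i j = 0.

Definition upper_band n (s : nat) (M : 'M[C]_n) : Prop :=
  forall i j : 'I_n, (i + s < j)%N -> M i j = 0.

Definition upper_triangular n (M : 'M[C]_n) : Prop := is_trig_mx M^T.

End Blocks.

Section Factorization.
Variables (C : numClosedFieldType) (r N : nat).
Implicit Types (A : 'M[C]_N) (V : 'M[C]_(r + 1)) (k : nat).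

(* V^*, with its rows split as 1 + r. *)
Definition adj V : 'M[C]_(1 + r, r + 1) :=
  castmx (addnC r 1, erefl (r + 1)%N) (V^t*).

(* V is unitary and V^* Delta = (xk; 0). *)
Definition annihilates V (xk : C) (Delta : 'cV[C]_(r + 1)) : Prop :=
  V \is unitarymx /\ adj V *m Delta = col_mx (xk%:M : 'M_1) (0 : 'cV_r).

Definition is_QR (Y Q Z : 'M[C]_r) : Prop :=
  [/\ Q \is unitarymx, upper_triangular Z & Y = Q *m Z].

Record qr_data := QRData {
  Umx : nat -> 'M[C]_(r + 1);
  xnum : nat -> C;
  Ytil0 : 'M[C]_(r, 2 * r + 1);
  Ytil : nat -> 'M[C]_(r, 2 * r);          (* k >= 1 *)
  Xtil : nat -> 'rV[C]_(2 * r);            (* k <= N - 2r *)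
  Ymx : forall k, 'M[C]_(r, N - k);        (* k >= N - 2r - 1 *)
  Xmx : forall k, 'rV[C]_(N - k);          (* k >= N - 2r *)
  Uhat : 'M[C]_r;
  Zlast : 'M[C]_r
}.

Definition Delta A k n (Yprev : 'M[C]_(r, n)) : 'cV[C]_(r + 1) :=
  col_mx (slice Yprev 1 1 : 'cV_r) (slice A (k + r) k : 'M_1).

(* Step 1.2 for index k; Yprev is the previous matrix Y~_{k-1}, which has
   2r + 1 columns for k = 1 and 2r columns otherwise. *)
Definition step_til A (D : qr_data) k n (Yprev : 'M[C]_(r, n)) : Prop :=
  annihilates (Umx D k) (xnum D k) (Delta A k Yprev) /\
  adj (Umx D k) *m
    conform_mx (0 : 'M_(r + 1, 2 * r))
      (block_mx (slice Yprev 1 2 : 'M_(r, 2 * r - 1)) (0 : 'cV_r)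
                (slice A (k + r) (k + 1) : 'rV_(2 * r - 1))
                (slice A (k + r) (k + 2 * r) : 'M_1))
  = col_mx (Xtil D k) (Ytil D k).

(* Step 1.3 for index k. *)
Definition step_last A (D : qr_data) k : Prop :=
  annihilates (Umx D k) (xnum D k) (Delta A k (Ymx D (k - 1))) /\
  adj (Umx D k) *m
    col_mx (slice (Ymx D (k - 1)) 1 2 : 'M_(r, N - k))
           (slice A (k + r) (k + 1) : 'rV_(N - k))
  = col_mx (Xmx D k) (Ymx D k).

Record qr_run A (D : qr_data) : Prop := QRRun {
  run_Ytil0 : Ytil0 D = slice A 1 1;
  run_til1 : (1 <= N - 2 * r - 1)%N -> step_til A D 1 (Ytil0 D);
  run_til : forall k, (2 <= k <= N - 2 * r - 1)%N ->
    step_til A D k (Ytil D (k - 1));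
  run_join0 : N = (2 * r + 1)%N ->
    Ymx D (N - 2 * r - 1) = conform_mx 0 (Ytil0 D);
  run_join : (2 * r + 1 < N)%N ->
    Ymx D (N - 2 * r - 1) =
    conform_mx 0 (row_mx (Ytil D (N - 2 * r - 1)) (0 : 'cV_r));
  run_last : forall k, (N - 2 * r <= k <= N - r)%N -> step_last A D k;
  (* X~_k = X_k; for k > N - 2r the row X~_k is just written X_k below. *)
  run_Xtil : Xtil D (N - 2 * r) = conform_mx 0 (Xmx D (N - 2 * r));
  run_QR : is_QR (conform_mx 0 (Ymx D (N - r))) (Uhat D) (Zlast D)
}.

Definition Utilde k V : 'M[C]_N :=
  conform_mx 0
    (dsum (1%:M : 'M_(k - 1)) (dsum V (1%:M : 'M_(N - k - r)))).

Definition Utilde_last (Q : 'M[C]_r) : 'M[C]_N :=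
  conform_mx 0 (dsum (1%:M : 'M_(N - r)) Q).

Definition Uprod (D : qr_data) : 'M[C]_N :=
  (\prod_(1 <= k < N - r + 1) Utilde k (Umx D k))
    *m Utilde_last (Uhat D).

Record R_entries (D : qr_data) (R : 'M[C]_N) : Prop := REntries {
  R_diag : forall k, (1 <= k <= N - r)%N -> entry R k k = xnum D k;
  R_til : forall k, (1 <= k <= N - 2 * r - 1)%N ->
    slice R k (k + 1) = Xtil D k;
  R_rows : forall k, (N - 2 * r <= k <= N - r)%N ->
    slice R k (k + 1) = Xmx D k;
  R_last : slice R (N - r + 1) (N - r + 1) = Zlast D
}.

(* a(i-1) a(i-2) ... a(j+1), equal to 1 when i = j + 1. *)
Definition aprod (a : nat -> 'M[C]_r) (i j : nat) : 'M[C]_r :=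
  \prod_(l <- rev (index_iota (j + 1) i)) a l.

(* plast is the r x r matrix p(N-r+1). *)
Record lower_green_generators (B : 'M[C]_N) (p : nat -> 'rV[C]_r)
    (q : nat -> 'cV[C]_r) (a : nat -> 'M[C]_r) (plast : 'M[C]_r) : Prop :=
  LowerGreenGenerators {
  green_first : forall i, (1 <= i <= N - r)%N ->
    (slice B i 1 : 'rV_r) = p i *m aprod a i 0;
  green_inner : forall i j, (1 <= j < i)%N -> (i <= N - r)%N ->
    (slice B i (r + j) : 'M_1) = p i *m aprod a i j *m q j;
  green_last_first :
    (slice B (N - r + 1) 1 : 'M_r) = plast *m aprod a (N - r + 1) 0;
  green_last : forall j, (1 <= j <= N - r)%N ->
    (slice B (N - r + 1) (r + j) : 'cV_r)
    = plast *m aprod a (N - r + 1) j *m q j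
}.

(* The partition V^* = (p_U d_U; a_U q_U). *)
Definition pU V : 'rV[C]_r := ulsubmx (adj V).
Definition dU V : 'M[C]_1 := ursubmx (adj V).
Definition aU V : 'M[C]_r := dlsubmx (adj V).
Definition qU V : 'cV[C]_r := drsubmx (adj V).

Record green_data := GreenData {
  gp : nat -> 'rV[C]_r;
  gq : nat -> 'cV[C]_r;
  ga : nat -> 'M[C]_r;
  gplast : 'M[C]_r;
  gP : forall k, 'M[C]_(N.+1 - k, r);      (* N-2r+1 <= k <= N-r+1 *)
  gt : nat -> 'M[C]_(2 * r, r)             (* 1 <= k <= N-2r+1 *)
}.

(* In run_p, the product X_k P_{k+1} typechecks because N.+1 - k.+1 is
   convertible to N - k. *)
Record green_run (D : qr_data) (G : green_data) : Prop := GreenRun {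
  run_q : forall k, (1 <= k <= N - r)%N -> gq G k = qU (Umx D k);
  run_a : forall k, (1 <= k <= N - r)%N -> ga G k = aU (Umx D k);
  run_plast : gplast G = invmx (Zlast D) *m (Uhat D)^t*;
  run_Plast : gP G (N - r).+1 = conform_mx 0 (gplast G);
  run_p : forall k, (N - 2 * r + 1 <= k <= N - r)%N ->
    gp G k = (xnum D k)^-1 *:
      (pU (Umx D k) - (Xmx D k *m (gP G k.+1 : 'M_(N - k, r)) *m ga G k));
  run_P : forall k, (N - 2 * r + 1 <= k <= N - r)%N ->
    gP G k = conform_mx 0 (col_mx (gp G k) (gP G k.+1 *m ga G k));
  run_t0 : gt G (N - 2 * r + 1) = conform_mx 0 (gP G (N - 2 * r + 1));
  run_pt : forall k, (1 <= k <= N - 2 * r)%N ->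
    gp G k = (xnum D k)^-1 *:
      (pU (Umx D k) - Xtil D k *m gt G k.+1 *m ga G k);
  run_t : forall k, (1 <= k <= N - 2 * r)%N ->
    gt G k = conform_mx 0
      (col_mx (gp G k) ((slice (gt G k.+1) 1 1 : 'M_(2 * r - 1, r)) *m ga G k))
}.

End Factorization.

(* Main.v *)
Require Import Defs.
From mathcomp Require Import all_boot all_order all_algebra.
From mathcomp Require Import reals complex.
From mathcomp Require Import zify.

Set Implicit Arguments.
Unset Strict Implicit.
Unset Printing Implicit Defensive.

Import Order.TTheory GRing.Theory Num.Theory.
Local Open Scope ring_scope.
Local Open Scope sesquilinear_scope.

(** The product of the elementary factors acts on a matrix [M] with [N] rows as
a sweep from top to bottom.  A state of [r] rows, initially the first [r] rows
of [M], is carried along; step [k] stacks the state on the row [k + r] of [M]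
and multiplies the result by [U_k^*]; the first row of the product is emitted
as row [k] of the result and the other [r] rows form the next state.  After
[N - r] steps the remaining state is multiplied by the adjoint of the last
factor.  Since every [U_k] is unitary each step can be undone, whence
[M = U * filtered M] for every [M] ([cascade_factorization]).  This identity is
used for two inputs.

Input [A].  Row [k + r] of a band matrix spans the columns [k] to
[k + 2r], so the state after step [k] vanishes to the right of column [k + 2r]
whatever the [U_k] are ([state_right]), and to the left of column [k + 1]
because each [U_k] annihilates the first column it meets
([state_left]).  The matrices computed by the algorithm are therefore exactly
the column windows of the full-width states and emitted rows ([run_tracks]),
and the output of the sweep is the upper triangular, upper band factor [R].
Conversely, choosing each [U_k] by Gram-Schmidt along the sweep and cutting out
these windows produces a run ([the_run_run]).

Input the identity.  Its output is [U^*], and the column [r + j] of its state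
after step [k >= j] is [a(k) ... a(j + 1) q(j)], while its first [r] columns are
[a(k) ... a(1)] ([E_inner], [E_first]): the new row of the identity enters at
column [k + r] only, so elsewhere a step is just multiplication by [a(k)].  Now
[B = A^-1] solves [R B = U^*].  Back substitution, performed on the columns up
to [k + r - 1] only, shows that the rows of [B] from [k] on are a fixed matrix
times the state of the identity after [k - 1] steps, and that this matrix obeys
the recursion of [P_k] ([represents_row], [represents_col]); as [R] has upper
bandwidth [2r], at most [2r] of its rows are ever needed, and these are the
rows of [t_k].  Substituting the explicit states gives the Green generators
([run_generators]). *)

(** * Entries and column blocks *)

Section EntryCalculus.
Variable C : numClosedFieldType.

Lemma entry_ord m n (M : 'M[C]_(m, n)) (i : 'I_m) (j : 'I_n) :
  entry M i.+1 j.+1 = M i j.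
Proof. by rewrite /entry /= !valK. Qed.

Lemma entry_row_out m n (M : 'M[C]_(m, n)) i j :
  (m <= i)%N -> entry M i.+1 j = 0.
Proof. by move=> le_mi; rewrite /entry /= insubF // ltnNge le_mi. Qed.

Lemma entry_col_out m n (M : 'M[C]_(m, n)) i j :
  (n <= j)%N -> entry M i j.+1 = 0.
Proof.
move=> le_nj; rewrite /entry /=; case: insub => // a.
by rewrite insubF // ltnNge le_nj.
Qed.

Lemma entry_inj m n (M M' : 'M[C]_(m, n)) :
  (forall i j, (i < m)%N -> (j < n)%N -> entry M i.+1 j.+1 = entry M' i.+1 j.+1) ->
  M = M'.
Proof. by move=> eqM; apply/matrixP=> i j; rewrite -!entry_ord eqM. Qed.

Lemma entry_slice m n (M : 'M[C]_(m, n)) i k m' n' a b :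
  (a < m')%N -> (b < n')%N ->
  entry (slice M i k : 'M_(m', n')) a.+1 b.+1 = entry M (i + a) (k + b).
Proof.
move=> lt_a lt_b; rewrite (entry_ord _ (Ordinal lt_a) (Ordinal lt_b)).
by rewrite mxE.
Qed.

Lemma entry_mx m n (F : 'I_m -> 'I_n -> C) i j (hi : (i < m)%N) (hj : (j < n)%N) :
  entry (\matrix_(a, b) F a b) i.+1 j.+1 = F (Ordinal hi) (Ordinal hj).
Proof. by rewrite (entry_ord _ (Ordinal hi) (Ordinal hj)) mxE. Qed.

Lemma entry0 m n i j : entry (0 : 'M[C]_(m, n)) i j = 0.
Proof. by rewrite /entry; case: insub => // a; case: insub => // b; rewrite mxE. Qed.

Lemma entry_castmx m n m' n' (e : (m = m') * (n = n')) (M : 'M[C]_(m, n)) i j :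
  entry (castmx e M) i j = entry M i j.
Proof. by case: e => e1 e2; case: m' / e1; case: n' / e2; rewrite castmx_id. Qed.

Lemma entry_conform m n m' n' (M0 : 'M[C]_(m', n')) (M : 'M[C]_(m, n)) i j :
  m = m' -> n = n' -> entry (conform_mx M0 M) i j = entry M i j.
Proof. by move=> em en; case: m' / em M0; case: n' / en => M0; rewrite conform_mx_id. Qed.

Lemma entry_col_mx m1 m2 n (X : 'M[C]_(m1, n)) (Y : 'M[C]_(m2, n)) i j :
  entry (col_mx X Y) i.+1 j.+1 =
  if (i < m1)%N then entry X i.+1 j.+1 else entry Y (i - m1).+1 j.+1.
Proof.
have [le_nj|lt_j] := leqP n j; first by rewrite !entry_col_out ?if_same.
have [le_i|lt_i] := leqP (m1 + m2) i.
  by rewrite entry_row_out // ltnNge (leq_trans (leq_addr _ _) le_i) /=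
             entry_row_out // leq_subRL // (leq_trans _ le_i) // leq_addr.
rewrite (entry_ord _ (Ordinal lt_i) (Ordinal lt_j)) mxE.
case: splitP => [a /= ->|a /= ->]; first by rewrite ltn_ord -entry_ord.
by rewrite ltnNge leq_addr /= addKn -entry_ord.
Qed.

Lemma entry_row_mx m n1 n2 (X : 'M[C]_(m, n1)) (Y : 'M[C]_(m, n2)) i j :
  entry (row_mx X Y) i.+1 j.+1 =
  if (j < n1)%N then entry X i.+1 j.+1 else entry Y i.+1 (j - n1).+1.
Proof.
have entry_tr p q (M : 'M[C]_(p, q)) a b : entry M^T a b = entry M b a.
  by rewrite /entry; case: insub => [u|]; case: insub => [v|] //; rewrite mxE.
by rewrite -entry_tr tr_row_mx entry_col_mx !entry_tr.
Qed.

Lemma entry_mul m n p (X : 'M[C]_(m, n)) (Y : 'M[C]_(n, p)) i j :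
  entry (X *m Y) i j = \sum_(1 <= l < n.+1) entry X i l * entry Y l j.
Proof.
rewrite big_add1 /= big_mkord.
case Di: (insub i.-1 : option 'I_m) => [a|]; last first.
  rewrite {1}/entry Di big1 // => l _.
  by rewrite {1}/entry Di mul0r.
case Dj: (insub j.-1 : option 'I_p) => [b|]; last first.
  rewrite {1}/entry Di Dj big1 // => l _.
  by rewrite [X in _ * X]/entry Dj; case: insub => [u|]; rewrite mulr0.
rewrite {1}/entry Di Dj mxE; apply: eq_bigr => l _.
by rewrite /entry Di Dj /= !valK.
Qed.

(** Column blocks commute with multiplication on the left, without any
condition on the range: columns that stick out of the matrix are zero on both
sides. *)
Lemma slice_mul m n p (V : 'M[C]_(m, n)) (X : 'M[C]_(n, p)) c p' :
  (slice (V *m X) 1 c : 'M_(m, p')) = V *m slice X 1 c.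
Proof.
apply: entry_inj => i j hi hj; rewrite entry_slice // !entry_mul !big_add1 /=.
rewrite !big_mkord; apply: eq_bigr => l _.
by rewrite entry_slice.
Qed.

Lemma slice_col_mx m1 m2 n (X : 'M[C]_(m1, n)) (Y : 'M[C]_(m2, n)) c n' :
  (slice (col_mx X Y) 1 c.+1 : 'M_(m1 + m2, n'))
  = col_mx (slice X 1 c.+1) (slice Y 1 c.+1).
Proof.
apply: entry_inj => i j hi hj; rewrite entry_slice // !entry_col_mx.
case: ltnP => hi1; first by rewrite entry_slice.
by rewrite entry_slice //; lia.
Qed.

Lemma slice_slice m n (M : 'M[C]_(m, n)) i k m1 n1 i' k' m2 n2 :
  (i' + m2 <= m1)%N -> (k' + n2 <= n1)%N ->
  (slice (slice M i k : 'M_(m1, n1)) i'.+1 k'.+1 : 'M_(m2, n2))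
  = slice M (i + i') (k + k').
Proof.
move=> hi hj; apply: entry_inj => a b ha hb.
rewrite [RHS]entry_slice // entry_slice // !addSn entry_slice ?addnA //; lia.
Qed.

End EntryCalculus.

(** * Unitary matrices and QR factorization *)

Section Unitary.
Variable C : numClosedFieldType.

Lemma unitary_dsum m n (V : 'M[C]_m) (W : 'M[C]_n) :
  V \is unitarymx -> W \is unitarymx -> dsum V W \is unitarymx.
Proof.
move=> /unitarymxP hV /unitarymxP hW; apply/unitarymxP.
rewrite /dsum tr_block_mx map_block_mx mulmx_block !trmx0 !map_mx0.
by rewrite !mulmx0 !mul0mx addr0 !add0r hV hW -scalar_mx_block.
Qed.

Lemma unitary1 n : (1%:M : 'M[C]_n) \is unitarymx.
Proof. by apply/unitarymxP; rewrite trmx1 map_mx1 mulmx1. Qed.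

Lemma unitary_conform m n (V : 'M[C]_m) :
  m = n -> V \is unitarymx -> (conform_mx 0 V : 'M[C]_n) \is unitarymx.
Proof. by move=> e; case: n / e; rewrite conform_mx_id. Qed.

Lemma unitary_trV n (V : 'M[C]_n) : V \is unitarymx -> V^t* *m V = 1%:M.
Proof. by move=> /unitarymxP /mulmx1C. Qed.

(** Gram-Schmidt on the rows of the transpose writes it as a lower triangular
matrix times a unitary one. *)
Lemma exists_QR n (Y : 'M[C]_n) :
  [/\ (schmidt Y^T)^T \is unitarymx,
      upper_triangular (((schmidt Y^T)^T)^t* *m Y)
    & Y = (schmidt Y^T)^T *m (((schmidt Y^T)^T)^t* *m Y)].
Proof.
have hB : schmidt Y^T \is unitarymx by exact: schmidt_unitarymx.
have hQ : (schmidt Y^T)^T \is unitarymx by rewrite trmx_unitary.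
split=> //; last first.
  by rewrite mulmxA (unitarymxP hQ) mul1mx.
have eqZ : ((((schmidt Y^T)^T)^t* *m Y)^T = Y^T *m (schmidt Y^T)^t*)%R.
  by rewrite trmx_mul trmxK map_trmx.
rewrite /upper_triangular eqZ; apply/is_trig_mxP => i j lt_ij.
have /sub_sumsmxP [u Du] := row_schmidt_sub Y^T i.
have -> : (Y^T *m (schmidt Y^T)^t*) i j = (row i Y^T *m (schmidt Y^T)^t*) 0 j.
  by rewrite -row_mul [RHS]mxE.
rewrite Du mulmx_suml summxE big1 // => k le_ki.
have /submxP [v ->] : (u k *m <<row k (schmidt Y^T)>> <= row k (schmidt Y^T))%MS.
  by rewrite (submx_trans (submxMl _ _)) // genmxE.
rewrite -mulmxA -row_mul (unitarymxP hB) mxE big1 // => a _.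
rewrite !mxE; case: eqP => [ekj|_]; last by rewrite mulr0.
by move: lt_ij; rewrite -ekj ltnNge le_ki.
Qed.

End Unitary.

(** * The cascade of elementary unitary factors *)

Section Cascade.
Variables (C : numClosedFieldType) (r N : nat).

Lemma unitary_Utilde k (V : 'M[C]_(r + 1)) :
  (1 <= k <= N - r)%N -> V \is unitarymx -> Utilde N k V \is unitarymx.
Proof.
move=> hk hV; apply: unitary_conform; first lia.
by do 2?[apply: unitary_dsum => //]; exact: unitary1.
Qed.

Lemma unitary_Utilde_last (Q : 'M[C]_r) :
  (r <= N)%N -> Q \is unitarymx -> Utilde_last N Q \is unitarymx.
Proof.
move=> hr hQ; apply: unitary_conform; first lia.
by apply: unitary_dsum => //; exact: unitary1.
Qed.

Lemma unitary_Uprod (D : qr_data C r N) :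
  (r <= N)%N -> (forall k, (1 <= k <= N - r)%N -> Umx D k \is unitarymx) ->
  Uhat D \is unitarymx -> Uprod D \is unitarymx.
Proof.
move=> hr hU hQ; apply: mul_unitarymx; last exact: unitary_Utilde_last.
rewrite big_nat; elim/big_ind: _ => [|V W hV hW|k hk]; first exact: unitary1.
  exact: mul_unitarymx.
by rewrite addn1 ltnS in hk; apply: unitary_Utilde => //; exact: hU.
Qed.

Lemma dsum1_mul n1 n2 m (V : 'M[C]_n2) (X : 'M[C]_(n1 + n2, m)) :
  dsum 1%:M V *m X = col_mx (usubmx X) (V *m dsubmx X).
Proof. by rewrite -{1}(vsubmxK X) mul_block_col mul1mx !mul0mx addr0 add0r. Qed.

Lemma dsum_1mul n1 n2 m (V : 'M[C]_n1) (X : 'M[C]_(n1 + n2, m)) :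
  dsum V 1%:M *m X = col_mx (V *m usubmx X) (dsubmx X).
Proof. by rewrite -{1}(vsubmxK X) mul_block_col mul1mx !mul0mx addr0 add0r. Qed.

Lemma entry_usubmx n1 n2 m (X : 'M[C]_(n1 + n2, m)) i j :
  (i < n1)%N -> entry (usubmx X) i.+1 j.+1 = entry X i.+1 j.+1.
Proof. by move=> hi; rewrite -{2}(vsubmxK X) entry_col_mx hi. Qed.

Lemma entry_dsubmx n1 n2 m (X : 'M[C]_(n1 + n2, m)) i j :
  entry (dsubmx X) i.+1 j.+1 = entry X (n1 + i).+1 j.+1.
Proof. by rewrite -{2}(vsubmxK X) entry_col_mx ltnNge leq_addr /= addKn. Qed.

(** Replaces the block form of the factor, with its transports between equal
dimensions, by its effect on entries: it acts by [V] on the rows [k], ...,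
[k + r] and fixes the others. *)
Lemma eq_Utilde_mul k (V : 'M[C]_(r + 1)) m (X Y : 'M[C]_(N, m)) :
  (1 <= k <= N - r)%N ->
  (slice X k 1 : 'M_(r + 1, m)) = V *m slice Y k 1 ->
  (forall i j, (i < N)%N -> (i.+1 < k)%N || (k + r <= i)%N ->
     entry X i.+1 j.+1 = entry Y i.+1 j.+1) ->
  X = Utilde N k V *m Y.
Proof.
move=> hk eq_in eq_out; rewrite /Utilde.
have: (k - 1 + (r + 1 + (N - k - r)))%N = N by lia.
have: k = (k - 1).+1 by lia.
move: (k - 1)%N (N - k - r)%N => n1 n2 ek en.
case: N / en X Y {hk} eq_in eq_out => X Y eq_in eq_out.
rewrite conform_mx_id dsum1_mul dsum_1mul.
have -> : usubmx (dsubmx Y) = slice Y k 1 :> 'M_(r + 1, m).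
  apply: entry_inj => i j hi hj.
  by rewrite entry_usubmx // entry_dsubmx entry_slice // ek addSn.
rewrite -eq_in; apply: entry_inj => i j hi hj.
rewrite !entry_col_mx; case: ltnP => h1.
  by rewrite eq_out ?entry_usubmx //; apply/orP; left; lia.
case: ltnP => h2; first by rewrite entry_slice //; congr entry; lia.
rewrite eq_out ?entry_dsubmx //; first by congr entry; lia.
by apply/orP; right; lia.
Qed.

Lemma eq_Utilde_last_mul (Q : 'M[C]_r) m (X Y : 'M[C]_(N, m)) :
  (r <= N)%N ->
  (slice X (N - r).+1 1 : 'M_(r, m)) = Q *m slice Y (N - r).+1 1 ->
  (forall i j, (i < N - r)%N -> entry X i.+1 j.+1 = entry Y i.+1 j.+1) ->
  X = Utilde_last N Q *m Y.
Proof.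
move=> hr eq_in eq_out; rewrite /Utilde_last.
have: (N - r + r)%N = N by lia.
move: (N - r)%N eq_in eq_out => n1 eq_in eq_out en.
case: N / en X Y eq_in eq_out {hr} => X Y eq_in eq_out.
rewrite conform_mx_id dsum1_mul.
have -> : dsubmx Y = slice Y n1.+1 1 :> 'M_(r, m).
  by apply: entry_inj => i j hi hj; rewrite entry_dsubmx entry_slice // addSn.
rewrite -eq_in; apply: entry_inj => i j hi hj.
rewrite !entry_col_mx; case: ltnP => h1; first by rewrite eq_out ?entry_usubmx.
by rewrite entry_slice //; [congr entry; lia|lia].
Qed.

Lemma entry_adj_mul (V : 'M[C]_(r + 1)) m (X : 'M[C]_(r + 1, m)) i j :
  entry (adj V *m X) i j = entry (V^t* *m X) i j.
Proof. by rewrite !entry_mul; apply: eq_bigr => l _; rewrite entry_castmx. Qed.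

Variables (U : nat -> 'M[C]_(r + 1)) (Q : 'M[C]_r).

(** The [r + 1] rows on which step [k] of the sweep acts. *)
Definition stack m (M : 'M[C]_(N, m)) k (S : 'M[C]_(r, m)) : 'M[C]_(r + 1, m) :=
  col_mx S (slice M (k + r) 1 : 'M_(1, m)).

(** The rows carried from one step of the sweep to the next, at full width:
with all [m] columns kept, every column evolves on its own and no change of
dimensions occurs between steps. *)
Fixpoint state m (M : 'M[C]_(N, m)) k : 'M[C]_(r, m) :=
  if k is k'.+1 then dsubmx (adj (U k) *m stack M k (state M k'))
  else slice M 1 1.

Definition out m (M : 'M[C]_(N, m)) k : 'rV[C]_m :=
  usubmx (adj (U k) *m stack M k (state M k.-1)).

(** The product of the first [k] adjoint factors with [M]: [k] emitted rows,
then the [r] rows of the state, then the rows of [M] not yet reached. *)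
Definition sweep m (M : 'M[C]_(N, m)) k : 'M[C]_(N, m) :=
  \matrix_(i, j) if (i < k)%N then out M i.+1 0 j
                 else if (i < k + r)%N then entry (state M k) (i - k).+1 j.+1
                 else M i j.

(** The complete output of the sweep, equal to the product of the adjoints of
all the factors with [M]. *)
Definition filtered m (M : 'M[C]_(N, m)) : 'M[C]_(N, m) :=
  \matrix_(i, j) if (i < N - r)%N then out M i.+1 0 j
                 else entry (Q^t* *m state M (N - r)) (i - (N - r)).+1 j.+1.

Lemma adj_stack m (M : 'M[C]_(N, m)) k :
  adj (U k.+1) *m stack M k.+1 (state M k)
  = col_mx (out M k.+1) (state M k.+1).
Proof. by rewrite /out /= vsubmxK. Qed.

Lemma entry_stack m (M : 'M[C]_(N, m)) k (S : 'M[C]_(r, m)) i j :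
  (i < r + 1)%N ->
  entry (stack M k.+1 S) i.+1 j.+1 =
  if (i < r)%N then entry S i.+1 j.+1 else entry M (k.+1 + r) j.+1.
Proof.
move=> hi; have [hj|hj] := leqP m j; first by rewrite !entry_col_out ?if_same.
by rewrite /stack entry_col_mx; case: ltnP => h //; rewrite entry_slice; 
  [congr entry; lia|lia|].
Qed.

Lemma entry_sweep m (M : 'M[C]_(N, m)) k i j : (i < N)%N ->
  entry (sweep M k) i.+1 j.+1 =
    if (i < k)%N then entry (out M i.+1) 1 j.+1
    else if (i < k + r)%N then entry (state M k) (i - k).+1 j.+1
    else entry M i.+1 j.+1.
Proof.
move=> hi; have [hj|hj] := leqP m j; first by rewrite !entry_col_out ?if_same.
rewrite entry_mx /= (entry_ord M (Ordinal hi) (Ordinal hj)).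
by rewrite -(entry_ord (out M i.+1) ord0 (Ordinal hj)).
Qed.

Lemma entry_filtered m (M : 'M[C]_(N, m)) i j : (i < N)%N ->
  entry (filtered M) i.+1 j.+1 =
    if (i < N - r)%N then entry (out M i.+1) 1 j.+1
    else entry (Q^t* *m state M (N - r)) (i - (N - r)).+1 j.+1.
Proof.
move=> hi; have [hj|hj] := leqP m j; first by rewrite !entry_col_out ?if_same.
rewrite entry_mx /=.
by rewrite -(entry_ord (out M i.+1) ord0 (Ordinal hj)).
Qed.

Hypothesis hr : (r <= N)%N.
Hypothesis U_unitary : forall k, (1 <= k <= N - r)%N -> U k \is unitarymx.
Hypothesis Q_unitary : Q \is unitarymx.

(** On rows [k + 1], ..., [k + 1 + r] the two sweeps are a stack and its image
by the adjoint of the unitary [U k.+1], hence differ by [U k.+1]; the other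
rows agree. *)
Lemma sweep_step m (M : 'M[C]_(N, m)) k : (k < N - r)%N ->
  sweep M k = Utilde N k.+1 (U k.+1) *m sweep M k.+1.
Proof.
move=> hk; apply: eq_Utilde_mul => [//| |i j hi /orP hik]; last first.
  rewrite !entry_sweep //; case: hik => hik.
    by rewrite !ifT //; lia.
  by rewrite !ifN //; lia.
have hV : U k.+1 \is unitarymx by exact: U_unitary.
have -> : (slice (sweep M k) k.+1 1 : 'M_(r + 1, m)) = stack M k.+1 (state M k).
  apply: entry_inj => i j hi hj; rewrite entry_slice // entry_stack // !addSn.
  rewrite entry_sweep; last lia.
  rewrite ltnNge leq_addr /= ltn_add2l addKn; case: ltnP => h //.
  by congr entry; lia.
have -> : (slice (sweep M k.+1) k.+1 1 : 'M_(r + 1, m))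
          = (U k.+1)^t* *m stack M k.+1 (state M k).
  apply: entry_inj => i j hi hj; rewrite entry_slice // -entry_adj_mul adj_stack.
  rewrite !addSn entry_sweep; last lia.
  rewrite entry_col_mx; case: i hi => [|i] hi /=.
    by rewrite addn0 ltnSn.
  rewrite ltnNge (_ : (k.+1 <= k + i.+1)%N) /=; last lia.
  rewrite (_ : (k + i.+1 < k.+1 + r)%N) /=; last lia.
  by congr entry; lia.
by rewrite mulmxA (unitarymxP hV) mul1mx.
Qed.

Lemma sweep0 m (M : 'M[C]_(N, m)) : sweep M 0 = M.
Proof.
apply: entry_inj => i j hi hj; rewrite entry_sweep //= add0n subn0.
by case: ltnP => h //; rewrite entry_slice.
Qed.

Lemma prod_Utilde_sweep m (M : 'M[C]_(N, m)) n : (n <= N - r)%N ->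
  M = (\prod_(1 <= k < n.+1) Utilde N k (U k)) *m sweep M n.
Proof.
elim: n => [|n IHn] hn; first by rewrite big_geq // sweep0 mul1mx.
rewrite {1}(IHn (ltnW hn)) (sweep_step M hn).
rewrite [X in _ = X *m _]big_nat_recr //=.
exact: mulmxA.
Qed.

Lemma sweep_last m (M : 'M[C]_(N, m)) :
  sweep M (N - r) = Utilde_last N Q *m filtered M.
Proof.
apply: eq_Utilde_last_mul => // [|i j hi]; last first.
  by rewrite entry_sweep ?entry_filtered ?hi //; lia.
have -> : (slice (sweep M (N - r)) (N - r).+1 1 : 'M_(r, m)) = state M (N - r).
  apply: entry_inj => i j hi hj; rewrite entry_slice // addSn entry_sweep; last lia.
  by rewrite ltnNge leq_addr /= ltn_add2l hi addKn.
have -> : (slice (filtered M) (N - r).+1 1 : 'M_(r, m)) = Q^t* *m state M (N - r).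
  apply: entry_inj => i j hi hj; rewrite entry_slice // addSn entry_filtered; last lia.
  by rewrite ltnNge leq_addr /= addKn.
by rewrite mulmxA (unitarymxP Q_unitary) mul1mx.
Qed.

Lemma cascade_factorization m (M : 'M[C]_(N, m)) :
  M = (\prod_(1 <= k < N - r + 1) Utilde N k (U k)) *m Utilde_last N Q
      *m filtered M.
Proof. by rewrite -mulmxA -sweep_last addn1 -prod_Utilde_sweep. Qed.

End Cascade.

(** * Determination steps and the windows of the sweep *)

Section Choices.
Variables (C : numClosedFieldType) (r : nat).

(** A QR factor of the square matrix all of whose columns are [Delta]:
triangularity of the other factor says precisely that its first column, the
image of [Delta], vanishes below the first entry. *)
Definition annihilator (Delta : 'cV[C]_(r + 1)) : 'M[C]_(r + 1) :=
  (schmidt (\matrix_(i < r + 1, j < r + 1) Delta i 0)^T)^T.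

Lemma annihilatorP (Delta : 'cV[C]_(r + 1)) :
  annihilates (annihilator Delta)
    (entry ((annihilator Delta)^t* *m Delta) 1 1) Delta.
Proof.
set Y : 'M[C]_(r + 1) := \matrix_(i < r + 1, j < r + 1) Delta i 0.
have [hQ hZ _] := exists_QR Y; split=> //.
apply: entry_inj => i j hi; rewrite ltnS leqn0 => /eqP ->.
rewrite entry_adj_mul entry_col_mx; case: i hi => [|i] hi /=.
  by rewrite [RHS](entry_ord _ (0 : 'I_1) (0 : 'I_1)) mxE.
rewrite entry0; have hi' : (i.+1 < r + 1)%N by lia.
have h0 : (0 < r + 1)%N by lia.
move/is_trig_mxP/(_ (Ordinal h0) (Ordinal hi') erefl): hZ.
rewrite mxE -entry_ord /= => <-; rewrite !entry_mul !big_add1 !big_mkord.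
apply: eq_bigr => l _; congr (_ * _).
rewrite (entry_ord Delta l (0 : 'I_1)).
by rewrite [RHS](entry_ord _ l (Ordinal h0)) mxE.
Qed.

End Choices.

Section Run.
Variables (C : numClosedFieldType) (r N : nat).
Variables (A : 'M[C]_N) (D : qr_data C r N).
Hypothesis hr : (0 < r)%N.
Hypothesis hN : (2 * r + 1 <= N)%N.
Hypothesis hA : band r A.

Let S k := state (Umx D) A k.
Let O k := out (Umx D) A k.

Lemma entry_band i j :
  (i + r < j)%N || (j + r < i)%N -> entry A i.+1 j.+1 = 0.
Proof.
move=> hij; have [hi|hi] := leqP N i; first by rewrite entry_row_out.
have [hj|hj] := leqP N j; first by rewrite entry_col_out.
by rewrite (entry_ord _ (Ordinal hi) (Ordinal hj)) hA //=; lia.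
Qed.

(** Multiplication on the left acts column by column, so a zero column of the
stacked rows stays zero. *)
Lemma column_zero k j :
  (forall i, (i < r)%N -> entry (S k) i.+1 j.+1 = 0) ->
  entry A (k.+1 + r) j.+1 = 0 ->
  entry (O k.+1) 1 j.+1 = 0 /\
  (forall i, (i < r)%N -> entry (S k.+1) i.+1 j.+1 = 0).
Proof.
move=> hS hAk.
have hz a : entry (adj (Umx D k.+1) *m stack A k.+1 (S k)) a j.+1 = 0.
  rewrite entry_mul big_add1 big_mkord big1 // => l _.
  by rewrite entry_stack //; case: ifP => hl; rewrite ?hS ?hAk // mulr0.
by split=> [|i hi]; rewrite /O /S /out /= (entry_usubmx, entry_dsubmx).
Qed.

(** Row [k + r] of a band matrix ends at column [k + 2r], and so do all rows
met before it. *)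
Lemma state_right k j i : (k + 2 * r <= j)%N -> (i < r)%N ->
  entry (S k) i.+1 j.+1 = 0.
Proof.
elim: k i => [|k IHk] i hj hi.
  have [hjN|hjN] := leqP N j; first by rewrite entry_col_out.
  by rewrite /S /= entry_slice // !add1n entry_band //; apply/orP; left; lia.
apply: (proj2 (column_zero (k := k) _ _)) => // [a ha|].
  by apply: IHk => //; lia.
by rewrite addSn entry_band //; apply/orP; left; lia.
Qed.

Lemma out_right k j : (k.+1 + 2 * r <= j)%N -> entry (O k.+1) 1 j.+1 = 0.
Proof.
move=> hj; apply: (proj1 (column_zero (k := k) _ _)) => // [a ha|].
  by apply: state_right => //; lia.
by rewrite addSn entry_band //; apply/orP; left; lia.
Qed.

(** A column that has been annihilated remains zero, because the rows that
enter later start to the right of it. *)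
Lemma state_left n :
  (forall k, (1 <= k <= n)%N -> (slice (S k) 1 k : 'cV_r) = 0) ->
  forall k j i, (k <= n)%N -> (j < k)%N -> (i < r)%N ->
  entry (S k) i.+1 j.+1 = 0.
Proof.
move=> hS; elim=> [|k IHk] j i hk hj hi //.
have [ejk|ltjk] := eqVneq j k.
  have := congr1 (fun X : 'cV_r => entry X i.+1 1) (hS k.+1 hk).
  by rewrite entry0 entry_slice // ejk addn0.
apply: (proj2 (column_zero (k := k) _ _)) => // [a ha|].
  by apply: IHk => //; lia.
by rewrite addSn entry_band //; apply/orP; right; lia.
Qed.

Lemma out_left n :
  (forall k, (1 <= k <= n)%N -> (slice (S k) 1 k : 'cV_r) = 0) ->
  forall k j, (k < n)%N -> (j < k)%N -> entry (O k.+1) 1 j.+1 = 0.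
Proof.
move=> hS k j hk hj.
apply: (proj1 (column_zero (k := k) _ _)) => // [a ha|].
  by apply: (state_left hS) => //; lia.
by rewrite addSn entry_band //; apply/orP; right; lia.
Qed.

Lemma slice_step k c n :
  adj (Umx D k.+1) *m (slice (stack A k.+1 (S k)) 1 c.+1 : 'M_(r + 1, n))
  = col_mx (slice (O k.+1) 1 c.+1) (slice (S k.+1) 1 c.+1).
Proof. by rewrite -slice_mul adj_stack slice_col_mx. Qed.

Lemma slice_stack k c n :
  (slice (stack A k.+1 (S k)) 1 c.+1 : 'M_(r + 1, n))
  = col_mx (slice (S k) 1 c.+1) (slice A (k.+1 + r) c.+1).
Proof.
rewrite /stack slice_col_mx; congr col_mx.
apply: entry_inj => i j; rewrite ltnS leqn0 => /eqP -> hj.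
rewrite [LHS]entry_slice // [RHS]entry_slice // !addn0 !addSn.
have [h|h] := leqP N (c + j); first by rewrite !entry_col_out.
by rewrite entry_slice // addn0.
Qed.

(** The defining condition on [U_k] and [x_k], read on the full-width sweep:
the column [k] of the emitted row is [x_k] and that of the new state is zero. *)
Lemma annihilates_slice k n (Y : 'M[C]_(r, n)) :
  (slice Y 1 1 : 'cV_r) = slice (S k) 1 k.+1 ->
  annihilates (Umx D k.+1) (xnum D k.+1) (Delta A k.+1 Y) <->
  [/\ Umx D k.+1 \is unitarymx,
      (slice (O k.+1) 1 k.+1 : 'M_1) = (xnum D k.+1)%:M
    & (slice (S k.+1) 1 k.+1 : 'cV_r) = 0].
Proof.
move=> hY; rewrite /annihilates /Delta hY -slice_stack slice_step.
by split=> [[hU /eq_col_mx[-> ->]]|[hU -> ->]].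
Qed.

(** The zero column that the algorithm appends to the previous window is the
true column of the full-width state, by [state_right].  An equivalence is
proved since one direction serves to analyse a given run and the other to
construct one. *)
Lemma step_tilE k n (Y : 'M[C]_(r, n)) :
  (k.+1 <= N - 2 * r - 1)%N ->
  (slice Y 1 1 : 'cV_r) = slice (S k) 1 k.+1 ->
  (slice Y 1 2 : 'M_(r, 2 * r - 1)) = slice (S k) 1 k.+2 ->
  step_til A D k.+1 Y <->
  annihilates (Umx D k.+1) (xnum D k.+1) (Delta A k.+1 Y) /\
  (slice (O k.+1) 1 k.+2 = Xtil D k.+1 /\ slice (S k.+1) 1 k.+2 = Ytil D k.+1).
Proof.
move=> hk hY1 hY2; rewrite /step_til hY2.
have -> : conform_mx 0 (block_mx (slice (S k) 1 k.+2 : 'M_(r, 2 * r - 1))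
      (0 : 'cV_r) (slice A (k.+1 + r) (k.+1 + 1) : 'rV_(2 * r - 1))
      (slice A (k.+1 + r) (k.+1 + 2 * r) : 'M_1))
  = slice (stack A k.+1 (S k)) 1 k.+2 :> 'M_(r + 1, 2 * r).
  apply: entry_inj => i j hi hj; rewrite entry_conform //; last lia.
  rewrite slice_stack !entry_col_mx; case: ltnP => hir.
    rewrite entry_row_mx [RHS]entry_slice // entry0; case: ltnP => hjr.
      by rewrite entry_slice.
    by rewrite !add1n addSn state_right //; lia.
  rewrite entry_row_mx [RHS]entry_slice //; last lia.
  by case: ltnP => hjr; rewrite entry_slice; try lia; congr entry; lia.
rewrite slice_step; split=> [[h /eq_col_mx[h1 h2]]|[h [h1 h2]]]; split=> //.
by rewrite h1 h2.
Qed.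

Lemma step_lastE k :
  (k.+1 <= N - r)%N -> Ymx D k = slice (S k) 1 k.+1 ->
  step_last A D k.+1 <->
  annihilates (Umx D k.+1) (xnum D k.+1) (Delta A k.+1 (Ymx D k)) /\
  (slice (O k.+1) 1 k.+2 = Xmx D k.+1 /\ slice (S k.+1) 1 k.+2 = Ymx D k.+1).
Proof.
move=> hk hY; rewrite /step_last subn1 /=.
rewrite [in slice (Ymx D k) 1 2]hY slice_slice //; last lia.
rewrite (addn0 1) (addn1 k.+1) -slice_stack slice_step.
split=> [[h /eq_col_mx[h1 h2]]|[h [h1 h2]]]; split=> //.
by rewrite h1 h2.
Qed.

(** The matrices computed by the algorithm are the nonzero column windows of
the full-width rows [O k] and states [S k]. *)
Record tracks k : Prop := Tracks {
  tracks_annihilates : (0 < k)%N ->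
    [/\ Umx D k \is unitarymx, (slice (O k) 1 k : 'M_1) = (xnum D k)%:M
      & (slice (S k) 1 k : 'cV_r) = 0];
  tracks_til : (1 <= k <= N - 2 * r - 1)%N ->
    slice (O k) 1 k.+1 = Xtil D k /\ slice (S k) 1 k.+1 = Ytil D k;
  tracks_X : (N - 2 * r <= k)%N -> slice (O k) 1 k.+1 = Xmx D k;
  tracks_Y : (N - 2 * r - 1 <= k)%N -> slice (S k) 1 k.+1 = Ymx D k
}.

(** The zero column appended at the passage from windows of fixed width to
windows that reach the last column of the matrix is again a true column of the
state, by [state_right]. *)
Lemma join_slice :
  (2 * r + 1 < N)%N ->
  let k := (N - 2 * r - 1)%N in
  conform_mx 0 (row_mx (slice (S k) 1 k.+1 : 'M_(r, 2 * r)) (0 : 'cV_r))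
  = slice (S k) 1 k.+1 :> 'M_(r, N - k).
Proof.
move=> hN' k; apply: entry_inj => i j hi hj.
rewrite entry_conform //; last by rewrite /k; lia.
rewrite entry_row_mx [RHS]entry_slice //; case: ltnP => hj2.
  by rewrite entry_slice.
by rewrite entry0 !addSn add0n state_right // /k; lia.
Qed.

(** The equations of each step determine the next windows from the previous
ones ([step_tilE], [step_lastE]), and the full-width sweep satisfies the same
equations. *)
Lemma run_tracks : qr_run A D -> forall k, (k <= N - r)%N -> tracks k.
Proof.
move=> hD; elim=> [|k IHk] hk.
  split=> // h0; first by lia.
  (* Only for this order are there no steps of fixed width, so that the initial
     state is already a window reaching the last column. *)
  have eN : N = (2 * r + 1)%N by lia.
  have := run_join0 hD eN.
  have -> : (N - 2 * r - 1)%N = 0%N by lia.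
  move=> ->; apply: entry_inj => i j hi hj; rewrite entry_conform //; last lia.
  by rewrite (run_Ytil0 hD) /= !entry_slice //; lia.
have {}IHk : tracks k by apply: IHk; lia.
have [htil|hlast] := leqP k.+1 (N - 2 * r - 1).
  have [ha [hX hY]] :
      [/\ Umx D k.+1 \is unitarymx,
          (slice (O k.+1) 1 k.+1 : 'M_1) = (xnum D k.+1)%:M
        & (slice (S k.+1) 1 k.+1 : 'cV_r) = 0] /\
      (slice (O k.+1) 1 k.+2 = Xtil D k.+1 /\
       slice (S k.+1) 1 k.+2 = Ytil D k.+1).
    case: k IHk hk htil => [|k] IHk hk htil.
      have h1 : (slice (Ytil0 D) 1 1 : 'cV_r) = slice (S 0) 1 1.
        rewrite (run_Ytil0 hD) slice_slice ?addn0; try lia.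
        by apply: entry_inj => i j hi hj; rewrite /= !entry_slice ?add1n //; lia.
      have h2 : (slice (Ytil0 D) 1 2 : 'M_(r, 2 * r - 1)) = slice (S 0) 1 2.
        rewrite (run_Ytil0 hD) slice_slice ?addn0; try lia.
        by apply: entry_inj => i j hi hj; rewrite /= !entry_slice ?add1n //; lia.
      have [/(annihilates_slice h1) ? ?] := (step_tilE htil h1 h2).1 (run_til1 hD htil).
      by [].
    have [_ hY] := tracks_til IHk (ltac:(lia)).
    have h1 : (slice (Ytil D k.+1) 1 1 : 'cV_r) = slice (S k.+1) 1 k.+2.
      by rewrite -hY slice_slice ?addn0; try lia.
    have h2 : (slice (Ytil D k.+1) 1 2 : 'M_(r, 2 * r - 1)) = slice (S k.+1) 1 k.+3.
      by rewrite -hY slice_slice ?addn0 ?addn1; try lia.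
    have := run_til hD (k := k.+2) htil; rewrite subn1 /=.
    by move=> /(step_tilE htil h1 h2)[/(annihilates_slice h1)].
  split=> //; first by lia.
  move=> hk1; have ek : k.+1 = (N - 2 * r - 1)%N by lia.
  have hN' : (2 * r + 1 < N)%N by lia.
  by rewrite ek (run_join hD hN') -ek -hY ek join_slice.
have hY : slice (S k) 1 k.+1 = Ymx D k by apply: tracks_Y IHk _; lia.
have h1 : (slice (Ymx D k) 1 1 : 'cV_r) = slice (S k) 1 k.+1.
  by rewrite -hY slice_slice ?addn0 //; lia.
have hk' : (N - 2 * r <= k.+1 <= N - r)%N by lia.
have /(step_lastE hk (esym hY))[/(annihilates_slice h1) ha [hX hY']] :=
  run_last hD hk'.
by split=> // ?; lia.
Qed.

End Run.

(** * The triangular factor and the existence of a run *)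

Section Outcome.
Variables (C : numClosedFieldType) (r N : nat).
Variables (A : 'M[C]_N) (D : qr_data C r N).
Hypothesis hr : (0 < r)%N.
Hypothesis hN : (2 * r + 1 <= N)%N.
Hypothesis hA : band r A.
Hypothesis hD : qr_run A D.

Let S k := state (Umx D) A k.
Let O k := out (Umx D) A k.
Let R := filtered (Umx D) (Uhat D) A.

Lemma Umx_unitary k : (1 <= k <= N - r)%N -> Umx D k \is unitarymx.
Proof.
move=> /andP[k1 k2].
by have [] := tracks_annihilates (run_tracks hr hN hA hD k2) k1.
Qed.

Lemma Uhat_unitary : Uhat D \is unitarymx.
Proof. by have [] := run_QR hD. Qed.

Lemma run_factorization : A = Uprod D *m R.
Proof.
apply: cascade_factorization; [lia|exact: Umx_unitary|exact: Uhat_unitary].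
Qed.

Lemma Uprod_unitary : Uprod D \is unitarymx.
Proof.
apply: unitary_Uprod; [lia|exact: Umx_unitary|exact: Uhat_unitary].
Qed.

Lemma run_killed k : (1 <= k <= N - r)%N -> (slice (S k) 1 k : 'cV_r) = 0.
Proof.
move=> /andP[k1 k2].
by have [] := tracks_annihilates (run_tracks hr hN hA hD k2) k1.
Qed.

Lemma R_last_block : (slice R (N - r + 1) (N - r + 1) : 'M_r) = Zlast D.
Proof.
have [hQ _ eY] := run_QR hD.
have ZE : Zlast D = (Uhat D)^t* *m conform_mx 0 (Ymx D (N - r)).
  by rewrite eY mulmxA unitary_trV // mul1mx.
rewrite ZE -(tracks_Y (run_tracks hr hN hA hD (leqnn _))); last lia.
have -> : conform_mx 0 (slice (S (N - r)) 1 (N - r).+1 : 'M_(r, N - (N - r)))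
        = slice (S (N - r)) 1 (N - r).+1 :> 'M_r.
  by apply: entry_inj => i j hi hj; rewrite entry_conform ?entry_slice //; lia.
rewrite -slice_mul; apply: entry_inj => i j hi hj.
rewrite !entry_slice // !addn1 !addSn entry_filtered; last lia.
by rewrite ltnNge leq_addr /= addKn.
Qed.

Lemma run_R_entries : R_entries D R.
Proof.
have hT k : (1 <= k <= N - r)%N -> tracks A D k.
  by move=> /andP[_ k2]; exact: (run_tracks hr hN hA hD k2).
have entry_R k j : (1 <= k <= N - r)%N ->
    entry R k j.+1 = entry (O k) 1 j.+1.
  case: k => // k hk; rewrite entry_filtered; last lia.
  by rewrite ifT //; lia.
split=> [k hk|k hk|k hk|]; last exact: R_last_block.
- have [k1 k2] : (0 < k)%N /\ (k <= N - r)%N by lia.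
  have [_ hx _] := tracks_annihilates (hT k hk) k1.
  have := congr1 (fun X : 'M_1 => entry X 1 1) hx; rewrite entry_slice // addn0.
  rewrite [RHS](entry_ord _ (0 : 'I_1) (0 : 'I_1)) mxE eqxx mulr1n => <-.
  by case: k k1 {k2 hx} hk => // k _ hk; rewrite addn0 entry_R.
- have hk' : (1 <= k <= N - r)%N by lia.
  have [<- _] := tracks_til (hT k hk') hk.
  apply: entry_inj => i j; rewrite ltnS leqn0 => /eqP -> hj.
  by rewrite !entry_slice // !addn0 addn1 addSn entry_R.
- have hk' : (1 <= k <= N - r)%N by lia.
  have k1 : (N - 2 * r <= k)%N by lia.
  rewrite -(tracks_X (hT k hk') k1).
  apply: entry_inj => i j; rewrite ltnS leqn0 => /eqP -> hj.
  by rewrite !entry_slice // !addn0 addn1 addSn entry_R.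
Qed.

Lemma entry_R_right i j : (i + 2 * r < j)%N -> entry R i.+1 j.+1 = 0.
Proof.
move=> hij; have [hj|hj] := leqP N j; first by rewrite entry_col_out.
have hi : (i < N - r)%N by lia.
rewrite entry_filtered ?hi; last lia.
by apply: out_right => //; lia.
Qed.

(** In the last [r] rows the columns up to [N - r] vanish because the final
state does, and the remaining square block is the triangular factor of the
final QR factorization. *)
Lemma entry_R_left i j : (j < i)%N -> entry R i.+1 j.+1 = 0.
Proof.
move=> hij; have [hi|hi] := leqP N i; first by rewrite entry_row_out.
have [hiN|hiN] := leqP (N - r) i; last first.
  rewrite entry_filtered // hiN.
  by apply: (out_left hr hN hA run_killed) => //; lia.
have [hjN|hjN] := leqP (N - r) j.
  have [_ hZ _] := run_QR hD; move: hZ; rewrite /upper_triangular -R_last_block.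
  have hi' : (i - (N - r) < r)%N by lia.
  have hj' : (j - (N - r) < r)%N by lia.
  move/is_trig_mxP/(_ (Ordinal hj') (Ordinal hi') ltac:(rewrite /=; lia)).
  by rewrite !mxE /= => <-; congr entry; lia.
rewrite entry_filtered // ltnNge hiN /= entry_mul big_add1 big_mkord big1 // => l _.
by rewrite (state_left hr hN hA run_killed) ?mulr0 //; lia.
Qed.

Lemma R_upper_triangular : upper_triangular R.
Proof.
apply/is_trig_mxP => i j lt_ij; rewrite mxE -entry_ord.
exact: entry_R_left.
Qed.

Lemma R_upper_band : upper_band (2 * r) R.
Proof. by move=> i j lt_ij; rewrite -entry_ord entry_R_right. Qed.

End Outcome.

Section Existence.
Variables (C : numClosedFieldType) (r N : nat).
Variable A : 'M[C]_N.
Hypothesis hr : (0 < r)%N.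
Hypothesis hN : (2 * r + 1 <= N)%N.
Hypothesis hA : band r A.

(** The factor of step [k] depends on the state left by the earlier factors,
so the states of the run are defined first, by [run_state], and the factors are
read off from them; [run_stateE] then identifies [run_state] with the sweep by
these factors. *)
Definition step_unitary k (S : 'M[C]_(r, N)) : 'M[C]_(r + 1) :=
  annihilator (slice (stack A k S) 1 k).

Fixpoint run_state k : 'M[C]_(r, N) :=
  if k is k'.+1
  then dsubmx (adj (step_unitary k (run_state k')) *m stack A k (run_state k'))
  else slice A 1 1.

Definition run_unitary k : 'M[C]_(r + 1) := step_unitary k (run_state k.-1).

Lemma run_stateE k : state run_unitary A k = run_state k.
Proof. by elim: k => //= k ->. Qed.

Definition the_run : qr_data C r N :=
  let S := state run_unitary A in
  let O := out run_unitary A in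
  let Y := slice (S (N - r)%N) 1 (N - r).+1 : 'M_r in
  let Q := (schmidt Y^T)^T in
  QRData run_unitary (fun k => entry (O k) 1 k) (slice A 1 1)
    (fun k => slice (S k) 1 k.+1) (fun k => slice (O k) 1 k.+1)
    (fun k => slice (S k) 1 k.+1) (fun k => slice (O k) 1 k.+1)
    Q (Q^t* *m Y).

Let S k := state run_unitary A k.
Let O k := out run_unitary A k.

Lemma the_run_annihilates k n (Y : 'M[C]_(r, n)) :
  (slice Y 1 1 : 'cV_r) = slice (S k) 1 k.+1 ->
  annihilates (run_unitary k.+1) (entry (O k.+1) 1 k.+1) (Delta A k.+1 Y).
Proof.
move=> hY; have hD : Delta A k.+1 Y = slice (stack A k.+1 (S k)) 1 k.+1.
  by rewrite /Delta hY (slice_stack _ the_run).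
have eV : run_unitary k.+1
          = annihilator (slice (stack A k.+1 (S k)) 1 k.+1 : 'cV_(r + 1)).
  by rewrite /run_unitary /step_unitary /= -run_stateE.
have := annihilatorP (slice (stack A k.+1 (S k)) 1 k.+1 : 'cV_(r + 1)).
rewrite hD -eV -entry_adj_mul (slice_step A the_run) entry_col_mx /=.
by rewrite entry_slice // !addn0.
Qed.

Lemma the_run_run : qr_run A the_run.
Proof.
have first c n : (0 < c)%N -> (c.-1 + n <= 2 * r + 1)%N ->
    (slice (slice A 1 1 : 'M_(r, 2 * r + 1)) 1 c : 'M_(r, n)) = slice (S 0) 1 c.
  case: c => //= c _ hc; rewrite slice_slice; [|lia|lia].
  apply: entry_inj => i j hi hj; rewrite /S /= [LHS]entry_slice // [RHS]entry_slice //.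
  by rewrite (addn0 1) !add1n !addSn entry_slice //; lia.
split=> //=.
- move=> hk; apply/step_tilE => //.
  + by apply: first; rewrite //=; lia.
  + by apply: first; rewrite //=; lia.
  + by split=> //; apply: the_run_annihilates; apply: first; rewrite //=; lia.
- case=> [|[|k]] // hk; rewrite subn1 /=.
  have h1 : (slice (slice (S k.+1) 1 k.+2 : 'M_(r, 2 * r)) 1 1 : 'cV_r)
            = slice (S k.+1) 1 k.+2 by rewrite slice_slice ?addn0 //; lia.
  have h2 : (slice (slice (S k.+1) 1 k.+2 : 'M_(r, 2 * r)) 1 2 : 'M_(r, 2 * r - 1))
            = slice (S k.+1) 1 k.+3 by rewrite slice_slice ?addn0 ?addn1 //; lia.
  apply/step_tilE => //.
  by split=> //; apply: the_run_annihilates.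
- move=> eN; apply: entry_inj => i j hi hj; rewrite entry_conform //; last lia.
  have -> : (N - 2 * r - 1)%N = 0%N by lia.
  by rewrite /= !entry_slice //; lia.
- by move=> hN'; symmetry; exact: (join_slice the_run hr hN hA hN').
- case=> [|k] hk; first by lia.
  apply/step_lastE => //; first lia.
  split=> //; apply: the_run_annihilates.
  by rewrite slice_slice ?addn0 //; lia.
- by apply: entry_inj => i j hi hj; rewrite entry_conform ?entry_slice //; lia.
set Y : 'M_r := slice _ 1 _.
have -> : conform_mx 0 (slice (S (N - r)) 1 (N - r).+1 : 'M_(r, N - (N - r))) = Y.
  by apply: entry_inj => i j hi hj; rewrite entry_conform ?entry_slice //; lia.
exact: exists_QR.
Qed.

End Existence.

(** * Green generators of the inverse *)

Section Green.
Variables (C : numClosedFieldType) (r N : nat).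

(** One step of back substitution in a system with an upper triangular band
matrix: row [k + 1] of the product involves only the row [k + 1] of [B] and the
window of the [w] rows that follow. *)
Lemma row_mul_window m (R : 'M[C]_N) (B : 'M[C]_(N, m)) k w c n :
  (k + 1 + w <= N)%N ->
  (forall j, (j < k)%N -> entry R k.+1 j.+1 = 0) ->
  (forall j, (k + 1 + w <= j)%N -> entry R k.+1 j.+1 = 0) ->
  (slice (R *m B) k.+1 c.+1 : 'rV_n) =
  entry R k.+1 k.+1 *: slice B k.+1 c.+1
  + (slice R k.+1 k.+2 : 'rV_w) *m slice B k.+2 c.+1.
Proof.
move=> hw hl hr; apply/matrixP => i j; rewrite !mxE !ord1 !addn0.
rewrite entry_mul big_add1 /=.
rewrite (big_cat_nat (n := k)) //=; last lia.
rewrite big_nat big1 ?add0r => [|l hlk]; last by rewrite hl ?mul0r //; lia.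
rewrite (big_cat_nat (n := k.+1)) //=; last lia.
rewrite big_nat1; congr (_ + _).
rewrite (big_cat_nat (n := (k.+1 + w)%N)) //=; [|lia|lia].
rewrite [X in _ + X]big_nat [X in _ + X]big1 ?addr0 => [|l hlk]; last first.
  by rewrite hr ?mul0r //; lia.
rewrite -{1}[k.+1]add0n big_addn addKn big_mkord; apply: eq_bigr => l _.
by rewrite !mxE !addn0 addnC -addSn.
Qed.

Lemma slice_rows_mul w w' m n (P : 'M[C]_(w, m)) (Y : 'M[C]_(m, n)) :
  (w' <= w)%N ->
  (slice P 1 1 : 'M_(w', m)) *m Y = slice (P *m Y) 1 1.
Proof.
move=> hw; apply: entry_inj => i j hi hj; rewrite entry_slice // !entry_mul.
by rewrite !big_add1 !big_mkord; apply: eq_bigr => l _; rewrite entry_slice.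
Qed.

Lemma aprod_empty (a : nat -> 'M[C]_r) k : aprod a k.+1 k = 1%:M.
Proof. by rewrite /aprod addn1 /index_iota subnn big_nil. Qed.

Lemma aprod_step (a : nat -> 'M[C]_r) k j :
  (j < k)%N -> aprod a k.+1 j = a k *m aprod a k j.
Proof.
move=> hjk; rewrite /aprod.
have -> : index_iota (j + 1) k.+1 = rcons (index_iota (j + 1) k) k.
  rewrite /index_iota subSn; last lia.
  by rewrite -(addn1 (k - (j + 1))) iotaD /= cats1 subnKC //; lia.
by rewrite rev_rcons big_cons.
Qed.

Variables (A : 'M[C]_N) (D : qr_data C r N).
Hypothesis hr : (0 < r)%N.
Hypothesis hN : (2 * r + 1 <= N)%N.
Hypothesis hA : band r A.
Hypothesis hD : qr_run A D.

Let U := Umx D.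
Let I : 'M[C]_N := 1%:M.
Let E k := state U I k.
Let R := filtered U (Uhat D) A.

Lemma entry_I i j : (i < N)%N -> entry I i.+1 j.+1 = (i == j)%:R.
Proof.
move=> hi; have [hj|hj] := leqP N j.
  by rewrite entry_col_out // (_ : i == j = false) //; apply/eqP; lia.
by rewrite (entry_ord _ (Ordinal hi) (Ordinal hj)) mxE.
Qed.

Lemma entry_I_off i j : i <> j -> entry I i.+1 j.+1 = 0.
Proof.
move=> /eqP/negPf nij; have [hi|hi] := leqP N i; first by rewrite entry_row_out.
by rewrite entry_I // nij.
Qed.

Lemma slice_I_left i c n : (i < N)%N -> (c + n <= i)%N ->
  (slice I i.+1 c.+1 : 'rV_n) = 0.
Proof.
move=> hi hc; apply: entry_inj => a b; rewrite ltnS leqn0 => /eqP -> hb.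
by rewrite entry_slice // entry0 addn0 addSn entry_I_off //; lia.
Qed.

Lemma slice_E_step k c n :
  (slice (out U I k.+1) 1 c.+1 : 'rV_n) =
    pU (U k.+1) *m slice (E k) 1 c.+1 + dU (U k.+1) *m slice I (k.+1 + r) c.+1
  /\ (slice (E k.+1) 1 c.+1 : 'M_(r, n)) =
    aU (U k.+1) *m slice (E k) 1 c.+1 + qU (U k.+1) *m slice I (k.+1 + r) c.+1.
Proof.
have := slice_step I D k c n; rewrite slice_stack.
rewrite -[adj _]submxK mul_block_col => /eq_col_mx[<- <-].
by [].
Qed.

(** On the columns up to [k + r] the row of the identity that enters at step
[k + 1] is zero, so the step reduces to a product by [p_U] or [a_U]. *)
Lemma slice_E_left k c n : (k < N - r)%N -> (c + n <= k + r)%N ->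
  (slice (out U I k.+1) 1 c.+1 : 'rV_n) = pU (U k.+1) *m slice (E k) 1 c.+1
  /\ (slice (E k.+1) 1 c.+1 : 'M_(r, n)) = aU (U k.+1) *m slice (E k) 1 c.+1.
Proof.
move=> hk hc; have [-> ->] := slice_E_step k c n.
by rewrite addSn slice_I_left ?mulmx0 ?addr0 //; lia.
Qed.

Lemma slice_E_right k c : (k <= N - r)%N -> (k + r <= c)%N ->
  (slice (E k) 1 c.+1 : 'cV_r) = 0.
Proof.
elim: k => [|k IHk] hk hc.
  apply: entry_inj => i j hi; rewrite ltnS leqn0 => /eqP ->.
  rewrite entry_slice // entry0 addn0 /E /=.
  have [hcN|hcN] := leqP N c; first by rewrite entry_col_out.
  by rewrite entry_slice // entry_I_off //; lia.
have [_ ->] := slice_E_step k c 1.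
rewrite IHk; [|lia|lia]; rewrite mulmx0 add0r.
have -> : (slice I (k.+1 + r) c.+1 : 'M_1) = 0; last by rewrite mulmx0.
apply: entry_inj => i j; rewrite !ltnS !leqn0 => /eqP -> /eqP ->.
by rewrite entry_slice // entry0 !addn0 addSn entry_I_off //; lia.
Qed.

Lemma slice_E_new k : (k < N - r)%N ->
  (slice (E k.+1) 1 (k + r).+1 : 'cV_r) = qU (U k.+1).
Proof.
move=> hk; have [_ ->] := slice_E_step k (k + r) 1.
rewrite slice_E_right; [|lia|lia]; rewrite mulmx0 add0r.
rewrite (_ : slice _ _ _ = 1%:M) ?mulmx1 //.
apply: entry_inj => i j; rewrite !ltnS !leqn0 => /eqP -> /eqP ->.
rewrite entry_slice // !addn0 addSn entry_I; last lia.
by rewrite eqxx [RHS](entry_ord _ (0 : 'I_1) (0 : 'I_1)) mxE eqxx.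
Qed.

Lemma E_first (a : nat -> 'M[C]_r) k : (k <= N - r)%N ->
  (forall l, (1 <= l <= N - r)%N -> a l = aU (U l)) ->
  (slice (E k) 1 1 : 'M_r) = aprod a k.+1 0.
Proof.
move=> hk ha; elim: k hk => [|k IHk] hk.
  rewrite aprod_empty /E /=.
  apply: entry_inj => i j hi hj; rewrite entry_slice // !add1n entry_slice //; last lia.
  rewrite !add1n entry_I; last lia.
  by rewrite [RHS](entry_ord _ (Ordinal hi) (Ordinal hj)) mxE.
rewrite aprod_step // ha // -IHk; last lia.
by have [] := slice_E_left (k := k) (c := 0) (n := r) hk (leq_addl _ _).
Qed.

Lemma E_inner (a : nat -> 'M[C]_r) k j : (k <= N - r)%N ->
  (forall l, (1 <= l <= N - r)%N -> a l = aU (U l)) ->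
  (1 <= j <= k)%N ->
  (slice (E k) 1 (r + j) : 'cV_r) = aprod a k.+1 j *m qU (U j).
Proof.
move=> hk ha; elim: k hk => [|k IHk] hk hj; first lia.
have [ej|nej] := eqVneq j k.+1.
  by rewrite ej aprod_empty mul1mx addnS addnC slice_E_new.
rewrite aprod_step; last lia.
rewrite ha // -mulmxA -IHk; [|lia|lia].
case: j {IHk} hj nej => // j hj nej; rewrite addnS.
have hj' : (r + j + 1 <= k + r)%N by lia.
by have [_ ->] := slice_E_left hk hj'.
Qed.

Hypothesis A_unit : A \in unitmx.
Let B := invmx A.

(** Both sides are the inverse of the unitary product: [cascade_factorization]
for the identity says so for the left side. *)
Lemma filtered_I : filtered U (Uhat D) I = (Uprod D)^t*.
Proof.
have hU := Uprod_unitary hr hN hA hD.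
have: I = Uprod D *m filtered U (Uhat D) I.
  apply: cascade_factorization; [lia| |exact: Uhat_unitary hD].
  exact: (Umx_unitary hr hN hA hD).
move=> /(congr1 (mulmx ((Uprod D)^t*))).
by rewrite mulmx1 mulmxA (unitary_trV hU) mul1mx.
Qed.

Lemma R_E : R = (Uprod D)^t* *m A.
Proof.
rewrite [in RHS](run_factorization hr hN hA hD) mulmxA.
by rewrite (unitary_trV (Uprod_unitary hr hN hA hD)) mul1mx.
Qed.

Lemma R_mul_inv : R *m B = filtered U (Uhat D) I.
Proof. by rewrite filtered_I R_E -mulmxA mulmxV // mulmx1. Qed.

Lemma R_unit : R \in unitmx.
Proof.
rewrite R_E unitmx_mul A_unit andbT unitarymx_unit // trmxC_unitary.
exact: (Uprod_unitary hr hN hA hD).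
Qed.

Lemma inv_factorization : invmx A = invmx R *m (Uprod D)^t*.
Proof. by rewrite -filtered_I -R_mul_inv mulmxA mulVmx ?R_unit // mul1mx. Qed.

Lemma unit_trig_diag n (T : 'M[C]_n) : upper_triangular T ->
  (T \in unitmx) = [forall i, T i i != 0].
Proof.
move=> hT; rewrite -unitmx_tr unitmxE unitfE (det_trig hT).
by apply/prodf_neq0/forallP => [h i|h i _]; have := h i; rewrite mxE // => ->.
Qed.

Lemma R_diag_neq0 i : (i < N)%N -> entry R i.+1 i.+1 != 0.
Proof.
move=> hi; have := R_unit; rewrite unit_trig_diag; last exact: R_upper_triangular.
by move=> /forallP /(_ (Ordinal hi)); rewrite -entry_ord.
Qed.

Lemma xnum_neq0 k : (1 <= k <= N - r)%N -> xnum D k != 0.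
Proof.
move=> hk; rewrite -(R_diag (run_R_entries hr hN hA hD) hk).
by case: k hk => // k hk; apply: R_diag_neq0; lia.
Qed.

Lemma Zlast_unit : Zlast D \in unitmx.
Proof.
rewrite unit_trig_diag; last by have [] := run_QR hD.
apply/forallP => i; rewrite -(R_last_block hr hN hA hD) mxE addn1 addSn.
by apply: R_diag_neq0; have := ltn_ord i; lia.
Qed.

(** The invariant of the back substitution: the [w] rows of [A^-1] that start
at row [k + 1] factor through the state of the identity after [k] steps.  In
general it holds only on the columns up to [k + r], outside of which the state
vanishes ([slice_E_right]); blocks of arbitrary width [n] are allowed so that it
applies both to the first [r] columns together and to single columns. *)
Definition represents k w (P : 'M[C]_(w, r)) : Prop :=
  forall c n, (c + n <= k + r)%N ->
    (slice B k.+1 c.+1 : 'M_(w, n)) = P *m slice (E k) 1 c.+1.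

(** The last [r] rows of [R A^-1 = U^*] involve only the last diagonal block
of [R], and the last rows of [U^*] are the adjoint of the last factor times the
final state. *)
Lemma represents_last :
  represents (N - r) (invmx (Zlast D) *m (Uhat D)^t*).
Proof.
move=> c n _; rewrite -mulmxA -slice_mul.
apply: (canRL (mulKmx Zlast_unit)).
rewrite -(R_last_block hr hN hA hD) addn1.
apply: entry_inj => i j hi hj; rewrite entry_slice //.
have -> : entry ((Uhat D)^t* *m E (N - r)) (1 + i) (c.+1 + j)
        = entry (R *m B) (N - r + i).+1 (c + j).+1.
  rewrite R_mul_inv entry_filtered; last lia.
  by rewrite ltnNge leq_addr /= addKn.
rewrite !entry_mul !big_add1 /= [RHS](big_cat_nat (n := (N - r)%N)) //=; last lia.
rewrite [X in _ = X + _]big_nat [X in _ = X + _]big1 ?add0r => [|l hl]; last first.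
  by rewrite (entry_R_left hr hN hA hD) ?mul0r //; lia.
have shift (F : nat -> C) :
    \sum_(N - r <= l < N) F l = \sum_(l < r) F (l + (N - r))%N.
  by rewrite -{1}[(N - r)%N]add0n big_addn subKn ?big_mkord //; lia.
rewrite shift big_mkord; apply: eq_bigr => l _; rewrite !entry_slice //.
by rewrite !addSn [(l + _)%N]addnC.
Qed.

(** Row [k + 1] of [R A^-1 = U^*] expresses [x A^-1(k + 1, :)] as [p_U] times
the state minus [X] times the rows below; these factor through the next state,
which on the columns concerned is [a_U] times the current one. *)
Lemma represents_row k w (X : 'rV[C]_w) (P : 'M[C]_(w, r)) :
  (k < N - r)%N -> (k + 1 + w <= N)%N ->
  (forall j, (k + 1 + w <= j)%N -> entry R k.+1 j.+1 = 0) ->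
  (slice R k.+1 k.+2 : 'rV_w) = X ->
  represents k.+1 P ->
  represents k ((xnum D k.+1)^-1 *: (pU (U k.+1) - X *m P *m aU (U k.+1))).
Proof.
move=> hk hw hR hX hP c n hc.
have hx : entry R k.+1 k.+1 = xnum D k.+1.
  by apply: (R_diag (run_R_entries hr hN hA hD)); lia.
have hx0 : xnum D k.+1 != 0 by apply: xnum_neq0.
have [eO eS] := slice_E_left hk hc.
have row_eq : pU (U k.+1) *m (slice (E k) 1 c.+1 : 'M_(r, n)) =
    xnum D k.+1 *: slice B k.+1 c.+1 + X *m (P *m (aU (U k.+1) *m slice (E k) 1 c.+1)).
  rewrite -eO -eS -hP; last lia.
  rewrite -hX -hx -row_mul_window //; last first.
    by move=> j hj; apply: (entry_R_left hr hN hA hD).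
  rewrite R_mul_inv; apply: entry_inj => i j; rewrite ltnS leqn0 => /eqP -> hj.
  by rewrite !entry_slice // !addn0 !addSn entry_filtered ?ifT //; lia.
rewrite -scalemxAl mulmxBl row_eq -!mulmxA addrK scalerA mulVf // scale1r.
by [].
Qed.

Lemma represents_shift k w (P : 'M[C]_(w, r)) :
  (k < N - r)%N -> represents k.+1 P ->
  forall c n, (c + n <= k + r)%N ->
  (slice B k.+2 c.+1 : 'M_(w, n)) = (P *m aU (U k.+1)) *m slice (E k) 1 c.+1.
Proof.
move=> hk hP c n hc; have [_ eS] := slice_E_left hk hc.
by rewrite -mulmxA -eS hP //; lia.
Qed.

Lemma represents_col k w (p : 'rV[C]_r) (P : 'M[C]_(w, r)) :
  (k < N - r)%N -> represents k p -> represents k.+1 P ->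
  represents k (col_mx p (P *m aU (U k.+1))).
Proof.
move=> hk hp hP c n hc; rewrite mul_col_mx -hp // -(represents_shift hk hP) //.
apply: entry_inj => i j hi hj; rewrite entry_col_mx entry_slice //.
case: i hi => [|i] hi /=; first by rewrite entry_slice.
by rewrite subn1 /= entry_slice // !addSn addnS.
Qed.

Lemma represents_conform k w w' (P : 'M[C]_(w, r)) :
  w = w' -> represents k P -> represents k (conform_mx (0 : 'M_(w', r)) P).
Proof. by move=> e; case: w' / e; rewrite conform_mx_id. Qed.

Lemma represents_take k w w' (P : 'M[C]_(w, r)) : (w' <= w)%N ->
  represents k P -> represents k (slice P 1 1 : 'M_(w', r)).
Proof.
move=> hw hP c n hc; rewrite slice_rows_mul // -hP //.
by apply: entry_inj => i j hi hj; rewrite !entry_slice //; lia.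
Qed.

Section Run.
Variable G : green_data C r N.
Hypothesis hG : green_run D G.

Lemma R_window_right k j : (k + 1 + 2 * r <= j)%N -> entry R k.+1 j.+1 = 0.
Proof. by move=> hj; apply: (entry_R_right D hr hN hA); lia. Qed.

Lemma ga_E k : (1 <= k <= N - r)%N -> ga G k = aU (U k).
Proof. by move=> hk; rewrite (run_a hG hk). Qed.

(** Downward induction on the row index, with [d] the number of steps taken
from the bottom. *)
Lemma gP_represents d k : (d <= r)%N -> k = (N - r - d)%N ->
  represents k (gP G k.+1) /\ ((0 < d)%N -> represents k (gp G k.+1)).
Proof.
elim: d k => [|d IHd] k hd ek.
  split=> // ; rewrite ek subn0 (run_Plast hG) (run_plast hG).
  by apply: represents_conform; [lia|exact: represents_last].
have [hP _] := IHd k.+1 (ltac:(lia)) (ltac:(lia)).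
have hk : (k < N - r)%N by lia.
have hk1 : (N - 2 * r + 1 <= k.+1 <= N - r)%N by lia.
have hk2 : (N - 2 * r <= k.+1 <= N - r)%N by lia.
have hp : represents k (gp G k.+1).
  rewrite (run_p hG hk1) ga_E //; apply: represents_row => //.
  - by lia.
  - by move=> j hj; rewrite entry_col_out //; lia.
  by rewrite -(R_rows (run_R_entries hr hN hA hD) hk2) addn1.
split=> // ; rewrite (run_P hG hk1) ga_E //.
by apply: represents_conform; [lia|exact: represents_col].
Qed.

(** The induction continues with windows of constant height [2r]: dropping the
last row of [t] is harmless since [R] has upper bandwidth [2r]. *)
Lemma gt_represents e k : (e <= N - 2 * r)%N -> k = (N - 2 * r - e)%N ->
  represents k (gt G k.+1) /\ ((0 < e)%N -> represents k (gp G k.+1)).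
Proof.
elim: e k => [|e IHe] k he ek.
  split=> //; have [hP _] := gP_represents (d := r) (k := k) (leqnn r) (ltac:(lia)).
  have -> : k.+1 = (N - 2 * r + 1)%N by lia.
  rewrite (run_t0 hG); apply: represents_conform; first lia.
  by have <- : k.+1 = (N - 2 * r + 1)%N by lia.
have [ht _] := IHe k.+1 (ltac:(lia)) (ltac:(lia)).
have hk : (k < N - r)%N by lia.
have hk1 : (1 <= k.+1 <= N - 2 * r)%N by lia.
have hp : represents k (gp G k.+1).
  rewrite (run_pt hG hk1) ga_E //.
  apply: represents_row => //; [lia|exact: R_window_right|].
  have [hk2|hk2] := leqP k.+1 (N - 2 * r - 1).
    have hk3 : (1 <= k.+1 <= N - 2 * r - 1)%N by lia.
    by rewrite -(R_til (run_R_entries hr hN hA hD) hk3) addn1.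
  have hk3 : k.+1 = (N - 2 * r)%N by lia.
  have hk4 : (N - 2 * r <= k.+1 <= N - r)%N by lia.
  have := R_rows (run_R_entries hr hN hA hD) hk4.
  rewrite hk3 (run_Xtil hD) => <-.
  apply: entry_inj => i j hi hj; rewrite entry_conform ?entry_slice //; try lia.
  by congr entry; lia.
split=> //; rewrite (run_t hG hk1) ga_E //.
apply: represents_conform; first lia.
by apply: represents_col => //; apply: represents_take => //; lia.
Qed.

Lemma gp_represents k : (k < N - r)%N -> represents k (gp G k.+1).
Proof.
move=> hk; have [hk2|hk2] := leqP (N - 2 * r) k.
  have [_] := gP_represents (d := N - r - k) (k := k) (ltac:(lia)) (ltac:(lia)).
  by apply; lia.
have [_] := gt_represents (e := N - 2 * r - k) (k := k) (ltac:(lia)) (ltac:(lia)).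
by apply; lia.
Qed.

Lemma run_generators : lower_green_generators B (gp G) (gq G) (ga G) (gplast G).
Proof.
split.
- case=> // k hk; rewrite -(E_first (k := k) (a := ga G)); [|lia|exact: ga_E].
  by rewrite gp_represents //; lia.
- case=> [|k] j hj hk; first lia.
  rewrite (run_q hG); last lia.
  rewrite -mulmxA -(E_inner (k := k) (a := ga G)); [|lia|exact: ga_E|lia].
  case: j hj => [|j] hj; first lia.
  by rewrite addnS gp_represents //; lia.
- rewrite addn1 -(E_first (k := N - r) (a := ga G)) //; last exact: ga_E.
  by rewrite (run_plast hG) represents_last //; lia.
- case=> [|j] hj; first lia.
  rewrite (run_q hG) // addn1 -mulmxA.
  rewrite -(E_inner (k := N - r) (a := ga G)) //; last exact: ga_E.
  by rewrite (run_plast hG) addnS represents_last //; lia.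
Qed.

End Run.
End Green.

(** * Existence of the back substitution data *)

Section GreenExistence.
Variables (C : numClosedFieldType) (r N : nat) (D : qr_data C r N).

Definition back_row w k (X : 'rV[C]_w) (P : 'M[C]_(w, r)) : 'rV[C]_r :=
  (xnum D k)^-1 *: (pU (Umx D k) - X *m P *m aU (Umx D k)).

(** The matrix [P_k] indexed by its number [d = N + 1 - k] of rows, so that the
recursion is structural and its type follows the index.  It starts from the last
generator, which is [P_(N - r + 1)], at [d = r]. *)
Fixpoint back_P d : 'M[C]_(d, r) :=
  if d is d'.+1 then
    if (d <= r)%N then conform_mx 0 (invmx (Zlast D) *m (Uhat D)^t*)
    else let k := (N - d')%N in
      col_mx (back_row k (Xmx D k) (conform_mx 0 (back_P d') : 'M_(N - k, r)))
             (back_P d' *m aU (Umx D k))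
  else 0.

(** The matrix [t_k] indexed by the number [e = N - 2r + 1 - k] of steps made
after the starting value [P_(N - 2r + 1)]. *)
Fixpoint back_t e : 'M[C]_(2 * r, r) :=
  if e is e'.+1 then
    let k := (N - 2 * r - e')%N in
    conform_mx 0 (col_mx (back_row k (Xtil D k) (back_t e'))
      ((slice (back_t e') 1 1 : 'M_(2 * r - 1, r)) *m aU (Umx D k)))
  else back_P (2 * r).

Lemma back_P_last d : (0 < d <= r)%N ->
  back_P d = conform_mx 0 (invmx (Zlast D) *m (Uhat D)^t*).
Proof. by case: d => //= d ->. Qed.

Lemma back_P_step k : (r <= N - k)%N -> (0 < N - k)%N ->
  back_P (N.+1 - k) =
  conform_mx 0 (col_mx (back_row k (Xmx D k) (back_P (N - k)))
                       (back_P (N - k) *m aU (Umx D k))).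
Proof.
move=> hr hk; have -> : (N.+1 - k)%N = (N - k).+1 by lia.
rewrite conform_mx_id /= leqNgt ltnS hr /=.
have -> : (N - (N - k))%N = k by lia.
by rewrite conform_mx_id.
Qed.

Definition the_green : green_data C r N :=
  GreenData
    (fun k => if (k <= N - 2 * r)%N
              then back_row k (Xtil D k) (back_t (N - 2 * r - k))
              else back_row k (Xmx D k) (back_P (N - k)))
    (fun k => qU (Umx D k)) (fun k => aU (Umx D k))
    (invmx (Zlast D) *m (Uhat D)^t*)
    (fun k => back_P (N.+1 - k)) (fun k => back_t (N - 2 * r + 1 - k)).

Hypothesis hr : (0 < r)%N.
Hypothesis hN : (2 * r + 1 <= N)%N.

Lemma the_green_run : green_run D the_green.
Proof.
split=> //=.
- have -> : (N.+1 - (N - r).+1)%N = r by lia.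
  by rewrite back_P_last ?hr ?leqnn.
- by move=> k hk; rewrite leqNgt (_ : (N - 2 * r < k)%N) //=; lia.
- move=> k hk; rewrite leqNgt (_ : (N - 2 * r < k)%N) /=; last lia.
  by apply: back_P_step; lia.
- have -> : (N.+1 - (N - 2 * r + 1))%N = (2 * r)%N by lia.
  by rewrite subnn conform_mx_id.
- move=> k /andP[hk hk2]; rewrite hk2.
  by have -> : (N - 2 * r + 1 - k.+1)%N = (N - 2 * r - k)%N by lia.
- move=> k /andP[hk hk2]; rewrite hk2.
  have -> : (N - 2 * r + 1 - k.+1)%N = (N - 2 * r - k)%N by lia.
  have -> : (N - 2 * r + 1 - k)%N = (N - 2 * r - k).+1 by lia.
  rewrite /=; have -> : (N - 2 * r - (N - 2 * r - k))%N = k by lia.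
  by [].
Qed.

End GreenExistence.

Theorem theorem4p4 (K : realType) (r N : nat)
    (hr : (0 < r)%N) (hN : (2 * r + 1 <= N)%N)
    (A : 'M[K[i]]_N) (hA : band r A) :
  (* every determination step of the algorithm can be carried out *)
  (forall Delta : 'cV[K[i]]_(r + 1),
     exists (V : 'M[K[i]]_(r + 1)) (x : K[i]), annihilates V x Delta) /\
  (forall Y : 'M[K[i]]_r, exists Q Z : 'M[K[i]]_r, is_QR Y Q Z) /\
  (exists D : qr_data (K[i]) r N, qr_run A D) /\
  (* whatever choices are made, the result is as announced *)
  (forall D : qr_data (K[i]) r N, qr_run A D ->
     Uprod D \is unitarymx /\
     exists R : 'M[K[i]]_N,
       [/\ upper_triangular R, upper_band (2 * r) R, R_entries D R,
           A = Uprod D *m R &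
           A \in unitmx ->
           [/\ R \in unitmx /\ invmx A = invmx R *m (Uprod D)^t*,
               (forall k, (1 <= k <= N - r)%N -> xnum D k != 0),
               Zlast D \in unitmx,
               (exists G : green_data (K[i]) r N, green_run D G) &
               (forall G : green_data (K[i]) r N, green_run D G ->
                  lower_green_generators (invmx A)
                    (gp G) (gq G) (ga G) (gplast G))]]).
Proof.
split; first by move=> Delta; do 2!eexists; exact: annihilatorP.
split; first by move=> Y; do 2!eexists; exact: exists_QR.
split; first by exists (the_run r A); exact: the_run_run.
move=> D hD; split; first exact: (Uprod_unitary hr hN hA hD).
exists (filtered (Umx D) (Uhat D) A); split.
- exact: (R_upper_triangular hr hN hA hD).
- exact: (R_upper_band D hr hN hA).
- exact: (run_R_entries hr hN hA hD).
- exact: (run_factorization hr hN hA hD).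
move=> A_unit; split.
- split; first exact: (R_unit hr hN hA hD A_unit).
  exact: (inv_factorization hr hN hA hD A_unit).
- by move=> k; exact: (xnum_neq0 hr hN hA hD A_unit).
- exact: (Zlast_unit hr hN hA hD A_unit).
- by exists (the_green D); exact: the_green_run.
- by move=> G; exact: (run_generators hr hN hA hD A_unit).
Qed.
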